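(* Let $M$ be a countable structure, let $G \leq \mathrm{Sym}(M)$ be a Polish group, and suppose that $\Phi \in \sigma \mathcal{K}_G$ is not weakly $\mathcal{K}_G$-injective. Then Eve has a winning strategy in $BM_p(G,\Phi)$.
   Context: $M$ is a countable first-order structure and $G\le\mathrm{Sym}(M)$ a group of permutations of $M$ which is Polish in the topology of pointwise convergence. A map $S:A\to B$ between substructures of $M$ is $G$-extendable if some $g\in G$ extends it. For a map $f$, $\mathrm{zdef}(f)=\mathrm{dom}(f)\cup\mathrm{rng}(f)$. $\mathcal{K}_G$ is the family of all $G$-extendable bijections between finitely generated substructures of $M$. For partial maps $S,T$ on $M$, an embedding of $S$ into $T$ is a $G$-extendable injection $\phi$ whose domain is a substructure of $M$ containing $\mathrm{zdef}(S)$ with $\phi\circ S\subseteq T\circ\phi$; it is an isomorphism if $\phi\circ S=T\circ\phi$. $S\le T$ means $S\subseteq T$ as graphs. $\sigma\mathcal{K}_G$ is the family of unions $\bigcup_k S_k$ of chains $S_0\le S_1\le\cdots$ in $\mathcal{K}_G$. $\Phi\in\sigma\mathcal{K}_G$ is weakly $\mathcal{K}_G$-injective if every element of $\mathcal{K}_G$ embeds into $\Phi$ and for every $S\in\mathcal{K}_G$ with $S\le\Phi$ there is $T\in\mathcal{K}_G$ with $S\le T\le\Phi$ such that for every $U\in\mathcal{K}_G$ with $T\le U$ there is an embedding $\phi:U\to\Phi$ with $\phi\restriction\mathrm{dom}(S)=\mathrm{Id}_{\mathrm{dom}(S)}$. The game $BM_p(G,\Phi)$: Eve and Odd alternately choose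 elements of $\mathcal{K}_G$, Eve first, forming $S_0\le S_1\le S_2\le\cdots$; Odd wins if $\bigcup_k S_k$ is isomorphic to $\Phi$.
   Formalization: The formal theorem additionally assumes that every element of G is an automorphism of the structure M; for an arbitrary Polish group of permutations of M, unrelated to its functions, the claim is false. *)

(* Defs.v *)
From HB Require Import structures.
From mathcomp Require Import all_boot all_order all_algebra.
From mathcomp Require Import all_classical all_reals topology.

Set Implicit Arguments.
Unset Strict Implicit.
Unset Printing Implicit Defensive.

Import Order.TTheory GRing.Theory Num.Theory.
Local Open Scope classical_set_scope.

Record language := Language {
  fun_symbol : Type;
  fun_arity : fun_symbol -> nat;
  rel_symbol : Type;
  rel_arity : rel_symbol -> nat }.

(* Constants are function symbols of arity 0. *)
Record structure (L : language) (M : Type) := Structure {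
  fun_interp : forall f : fun_symbol L, (fun_arity f).-tuple M -> M;
  rel_interp : forall r : rel_symbol L, set ((rel_arity r).-tuple M) }.

Section FirstOrder.
Variables (L : language) (M : Type) (str : structure L M).

(* The empty set is a substructure when L has no constants. *)
Definition substructure (A : set M) : Prop :=
  forall (f : fun_symbol L) (t : (fun_arity f).-tuple M),
    (forall i, A (tnth t i)) -> A (fun_interp str t).

Definition fg_substructure (A : set M) : Prop :=
  exists2 F : set M, finite_set F & A = smallest substructure F.

Definition automorphism (g : M -> M) : Prop :=
  [/\ bijective g,
      forall (f : fun_symbol L) (t : (fun_arity f).-tuple M),
        g (fun_interp str t) = fun_interp str (map_tuple g t)
    & forall (r : rel_symbol L) (t : (rel_arity r).-tuple M),
        rel_interp str t <-> rel_interp str (map_tuple g t)].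

End FirstOrder.

Section PermutationGroup.
Variable M : Type.

Definition permutation_group (G : set (M -> M)) : Prop :=
  [/\ forall g, G g -> bijective g,
      G id,
      forall g h, G g -> G h -> G (g \o h)
    & forall g h, G g -> cancel g h -> cancel h g -> G h].

End PermutationGroup.

Section Polish.
Variables (R : realType) (T : topologicalType).
Local Open Scope ring_scope.

Definition is_metric (d : T -> T -> R) : Prop :=
  [/\ forall x y, d x y = 0 <-> x = y,
      forall x y, d x y = d y x
    & forall x y z, d x z <= d x y + d y z].

Definition metric_compatible (d : T -> T -> R) : Prop :=
  forall U : set T, open U <->
    (forall x, U x -> exists2 e : R, 0 < e & forall y, d x y < e -> U y).

Definition metric_complete (d : T -> T -> R) : Prop :=
  forall u : nat -> T,
    (forall e : R, 0 < e -> exists N : nat, forall m n : nat,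
       (N <= m)%N -> (N <= n)%N -> d (u m) (u n) < e) ->
    exists x : T, forall e : R, 0 < e -> exists N : nat, forall n : nat,
       (N <= n)%N -> d (u n) x < e.

Definition polish : Prop :=
  (exists2 D : set T, countable D & dense D) /\
  (exists d : T -> T -> R,
     [/\ is_metric d, metric_compatible d & metric_complete d]).

End Polish.

(* G carries the subspace topology inherited from M^M, M being discrete. *)
Definition polish_group (R : realType) (M : choiceType) (G : set (M -> M)) : Prop :=
  polish R (set_type (G : set {ptws discrete_topology M -> discrete_topology M})).

(* Partial maps on M are represented by their graphs, so that S <= T is
   inclusion. *)
Notation partial_map M := (set (M * M)).

Section PartialMaps.
Variables (L : language) (M : Type) (str : structure L M) (G : set (M -> M)).
Implicit Types S T U phi Phi : partial_map M.

Definition pdom S : set M := fst @` S.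
Definition prng S : set M := snd @` S.
Definition zdef S : set M := pdom S `|` prng S.

(* The graph of phi o S, defined at x iff S is defined at x and phi at S(x). *)
Definition pcomp phi S : partial_map M :=
  [set p | exists2 y, S (p.1, y) & phi (y, p.2)].

(* As G consists of permutations, such an S is the graph of an injection. *)
Definition extendable S : Prop :=
  exists2 g, G g & forall x y, S (x, y) -> y = g x.

Definition KG : set (partial_map M) :=
  [set S | [/\ fg_substructure str (pdom S), fg_substructure str (prng S)
             & extendable S]].

Definition embedding S T phi : Prop :=
  [/\ extendable phi, substructure str (pdom phi), zdef S `<=` pdom phi
    & pcomp phi S `<=` pcomp T phi].

Definition isomorphism S T phi : Prop :=
  embedding S T phi /\ pcomp phi S = pcomp T phi.

Definition isomorphic S T : Prop := exists phi, isomorphism S T phi.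

Definition sigmaKG : set (partial_map M) :=
  [set Phi | exists S : nat -> partial_map M,
     [/\ forall n, KG (S n), forall n, S n `<=` S n.+1
       & Phi = \bigcup_n S n]].

Definition weakly_injective Phi : Prop :=
  (forall S, KG S -> exists phi, embedding S Phi phi) /\
  (forall S, KG S -> S `<=` Phi ->
     exists T, [/\ KG T, S `<=` T, T `<=` Phi
       & forall U, KG U -> T `<=` U ->
           exists2 phi, embedding U Phi phi
                      & forall x, pdom S x -> phi (x, x)]).

(* The finite sequences S_0 <= ... <= S_(n-1) of moves in the game; Eve makes
   the moves of even index. *)
Definition position (h : seq (partial_map M)) : Prop :=
  (forall i, (i < size h)%N -> KG (nth set0 h i)) /\
  (forall i, (i.+1 < size h)%N -> nth set0 h i `<=` nth set0 h i.+1).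

Definition eve_strategy (sigma : seq (partial_map M) -> partial_map M) : Prop :=
  forall h, ~~ odd (size h) -> position h -> position (rcons h (sigma h)).

Definition eve_winning_strategy Phi (sigma : seq (partial_map M) -> partial_map M) : Prop :=
  eve_strategy sigma /\
  forall S : nat -> partial_map M,
    (forall n, position (mkseq S n)) ->
    (forall k, S k.*2 = sigma (mkseq S k.*2)) ->
    ~ isomorphic (\bigcup_n S n) Phi.

End PartialMaps.

(* Main.v *)
Require Import Defs.
From mathcomp Require Import all_boot.
From mathcomp Require Import all_classical all_reals topology.

(** If some [S] in [KG] does not embed into [Phi], Eve opens with [S].
    Otherwise weak injectivity fails at some [S <= Phi]: every [T] between [S]
    and [Phi] has an extension [U] with no embedding into [Phi] fixing
    [dom S].  Eve makes the final union total, so that an isomorphism onto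
    [Phi] would be (the graph of) some [g] in [G], and she rules out in turn
    each of the countably many values [a] that [g^-1] may take on a finite tuple
    generating [dom S].  If the current position [P] is mapped into [Phi] by
    some [g0] with [g0^-1] of value [a], then [g0 P] and [S] lie in a common
    [T <= Phi], and Eve plays the pullback of the corresponding [U] along [g0].
    Any later [g] with the same value [a] mapping the union into [Phi] would
    make [g g0^-1] an embedding of [U] fixing [dom S]. *)

Set Implicit Arguments.
Unset Strict Implicit.
Unset Printing Implicit Defensive.

Local Open Scope classical_set_scope.

(** * Substructures under automorphisms *)

Section Substructures.
Variables (L : language) (M : Type) (str : structure L M).
Implicit Types A F : set M.

Lemma substructure_smallest F : substructure str (smallest (substructure str) F).
Proof.
move=> f t tF A [subA FA]; apply: (subA) => i.
exact: (tF i A (conj subA FA)).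
Qed.

Lemma fg_substructure_sub A : fg_substructure str A -> substructure str A.
Proof. by move=> [F _ ->]; exact: substructure_smallest. Qed.

Lemma substructure_preimage g A :
  automorphism str g -> substructure str A -> substructure str (g @^-1` A).
Proof.
move=> [_ gf _] subA f t tA; rewrite /preimage /= gf; apply: subA => i.
by rewrite tnth_map; exact: tA.
Qed.

(** This lets an automorphism that fixes a generating tuple fix the whole generated substructure. *)
Lemma substructure_fixed g :
  automorphism str g -> substructure str [set x | g x = x].
Proof.
move=> [_ gf _] f t tA; rewrite /= gf; congr fun_interp.
by apply: eq_from_tnth => i; rewrite tnth_map; exact: tA.
Qed.

Lemma image_smallest g h F : automorphism str g -> automorphism str h ->
  cancel g h -> cancel h g ->
  g @` smallest (substructure str) F = smallest (substructure str) (g @` F).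
Proof.
move=> autg auth gK hK; apply/seteqP; split.
- move=> _ [x xF <-].
  apply: (xF (g @^-1` smallest (substructure str) (g @` F))); split.
    by apply: substructure_preimage => //; exact: substructure_smallest.
  by move=> y Fy A [_]; apply; exists y.
- move=> x xF.
  suff hx : (h @^-1` smallest (substructure str) F) x by exists (h x).
  apply: xF; split.
    by apply: substructure_preimage => //; exact: substructure_smallest.
  by move=> _ [y Fy <-]; rewrite /preimage /= gK => A [_]; apply.
Qed.

Lemma fg_substructure_image g h A : automorphism str g -> automorphism str h ->
  cancel g h -> cancel h g ->
  fg_substructure str A -> fg_substructure str (g @` A).
Proof.
move=> autg auth gK hK [F finF ->]; exists (g @` F); first exact: finite_image.
exact: (image_smallest F autg auth gK hK).
Qed.

End Substructures.

(** For bijective [g] this is the graph of the conjugate of [X] by [g]; moving the pairs of the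
    graph avoids naming the inverse. *)
Definition conj_map (M : Type) (g : M -> M) (X : partial_map M) : partial_map M :=
  (fun p => (g p.1, g p.2)) @` X.

Lemma pdom_conj_map (M : Type) (g : M -> M) (X : partial_map M) :
  pdom (conj_map g X) = g @` pdom X.
Proof. by rewrite /pdom /conj_map !image_comp. Qed.

Lemma prng_conj_map (M : Type) (g : M -> M) (X : partial_map M) :
  prng (conj_map g X) = g @` prng X.
Proof. by rewrite /prng /conj_map !image_comp. Qed.

Lemma pdomS (M : Type) (X Y : partial_map M) : X `<=` Y -> pdom X `<=` pdom Y.
Proof. by move=> XY _ [p Xp <-]; exists p => //; exact: XY. Qed.

Lemma zdefS (M : Type) (X Y : partial_map M) : X `<=` Y -> zdef X `<=` zdef Y.
Proof.
by move=> XY; apply: setUSS => _ [p Xp <-]; exists p => //; exact: XY.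
Qed.

Lemma embeddingSl (L : language) (M : Type) (str : structure L M)
    (G : set (M -> M)) (X Y Z phi : partial_map M) :
  X `<=` Y -> embedding str G Y Z phi -> embedding str G X Z phi.
Proof.
move=> XY [ext sub zd inc]; split => //.
- by apply: subset_trans zd; exact: zdefS.
- by apply: subset_trans inc => p [y Xy phiy]; exists y => //; exact: XY.
Qed.

Lemma chain_subset (T : Type) (S : nat -> set T) :
  (forall n, S n `<=` S n.+1) -> forall m n, m <= n -> S m `<=` S n.
Proof.
move=> Sinc m n; elim: n => [|n IHn]; first by rewrite leqn0 => /eqP ->.
rewrite leq_eqVlt => /predU1P[-> //|]; rewrite ltnS => /IHn mn.
by apply: subset_trans mn _.
Qed.

(** * Extensions within [KG], and the strategies they yield *)

Section ExtendableMaps.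
Variables (L : language) (M : choiceType) (str : structure L M).
Variable G : set (M -> M).
Hypothesis Ggroup : permutation_group G.
Hypothesis Gaut : forall g : M -> M, G g -> automorphism str g.
Implicit Types P Q S T U X Phi : partial_map M.

Lemma permutation_group_inv g : G g ->
  exists h, [/\ G h, cancel g h & cancel h g].
Proof.
case: Ggroup => bij _ _ inv Gg; case: (bij _ Gg) => h gh hg.
by exists h; split => //; exact: inv gh hg.
Qed.

Lemma extendable_fun X x y z : extendable G X -> X (x, y) -> X (x, z) -> y = z.
Proof. by move=> [g _ gX] /gX -> /gX ->. Qed.

Lemma KG_conj_map g X : G g -> KG str G X -> KG str G (conj_map g X).
Proof.
move=> Gg [domX rngX [k Gk kX]].
have [h [Gh gh hg]] := permutation_group_inv Gg.
split.
- rewrite pdom_conj_map.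
  exact: (fg_substructure_image (Gaut Gg) (Gaut Gh) gh hg).
- rewrite prng_conj_map.
  exact: (fg_substructure_image (Gaut Gg) (Gaut Gh) gh hg).
- case: Ggroup => _ _ comp _.
  exists (g \o (k \o h)); first exact: comp _ _ Gg (comp _ _ Gk Gh).
  by move=> _ _ [[x y] /kX -> [<- <-]] /=; rewrite gh.
Qed.

(** Take some [g] in [G] extending [X] and restrict it to the substructure generated by [z] and the
    generators of [pdom X]. *)
Lemma KG_extend_pdom X z : KG str G X ->
  exists Y, [/\ KG str G Y, X `<=` Y & pdom Y z].
Proof.
move=> [[F finF domX] rngX [g Gg gX]].
have [h [Gh gh hg]] := permutation_group_inv Gg.
pose A := smallest (substructure str) (F `|` [set z]).
have fgA : fg_substructure str A.
  exists (F `|` [set z]) => //.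
  by rewrite finite_setU; split => //; exact: finite_set1.
exists ((fun x => (x, g x)) @` A); split; first split.
- suff -> : pdom ((fun x => (x, g x)) @` A) = A by [].
  by rewrite /pdom image_comp image_id.
- suff -> : prng ((fun x => (x, g x)) @` A) = g @` A.
    exact: (fg_substructure_image (Gaut Gg) (Gaut Gh) gh hg).
  by rewrite /prng image_comp.
- by exists g => // x y [u _ [<- <-]].
- move=> [x y] Xxy; rewrite (gX _ _ Xxy); exists x => //.
  have : pdom X x by exists (x, y).
  rewrite domX => Fx B [subB FB]; apply: Fx; split => //.
  by move=> u Fu; apply: FB; left.
- by exists (z, g z) => //; exists z => // B [_]; apply; right.
Qed.

(** The finitely many generators of [pdom X] lie in the domain of one [S n], which is a substructure
    and so contains [pdom X]. The values agree because a later member of the chain is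
    single-valued. *)
Lemma KG_subset_bigcup X (S : nat -> partial_map M) : KG str G X ->
  (forall n, KG str G (S n)) -> (forall n, S n `<=` S n.+1) ->
  X `<=` \bigcup_n S n -> exists n, X `<=` S n.
Proof.
move=> [[F /finite_seqP[s ->] domX] _ extX] KS Sinc XS.
have Smono := chain_subset Sinc.
have domXS x : pdom X x -> exists n, pdom (S n) x.
  by move=> [p /XS[n _ Sp] <-]; exists n, p.
have [n sn] : exists n, forall x, x \in s -> pdom (S n) x.
  have : forall x, x \in s -> pdom X x.
    by rewrite domX => x xs A [_]; apply.
  elim: (s) => [|x r IH] rX; first by exists 0.
  have [i Sx] := domXS _ (rX x (mem_head _ _)).
  have [|j Sr] := IH; first by move=> y yr; apply: rX; rewrite inE yr orbT.
  exists (maxn i j) => y; rewrite inE => /predU1P[->|/Sr].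
    by apply: pdomS Sx; apply: Smono; exact: leq_maxl.
  by apply: pdomS; apply: Smono; exact: leq_maxr.
exists n => -[x y] Xxy.
have [m _ Sxy] := XS _ Xxy.
have : pdom (S n) x.
  have : pdom X x by exists (x, y).
  rewrite domX; apply; split; last by move=> u; exact: sn.
  by case: (KS n) => fgS _ _; exact: fg_substructure_sub.
move=> [[x' y'] Sxy' /= ex]; rewrite {x'}ex in Sxy'.
have [_ _ ext] := KS (maxn m n).
suff -> : y = y' by [].
apply: (extendable_fun ext (x := x)).
- exact: (Smono _ _ (leq_maxl m n)).
- exact: (Smono _ _ (leq_maxr m n)).
Qed.

(** Reduces the game to a list of tasks: [E k] performs task [k] on whatever position [P] Odd has
    left. *)
Lemma eve_wins_by_extending Phi S0 (E : nat -> partial_map M -> partial_map M) :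
  KG str G S0 ->
  (forall k P, KG str G P -> KG str G (E k P) /\ P `<=` E k P) ->
  (forall X, S0 `<=` X ->
     (forall k, exists2 P, KG str G P & E k P `<=` X) ->
     ~ isomorphic str G X Phi) ->
  exists sigma, eve_winning_strategy str G Phi sigma.
Proof.
move=> KS0 EP EX; exists (fun h => E (size h)./2 (last S0 h)).
have Klast h : position str G h -> KG str G (last S0 h).
  case: h => [//|x h] [Kh _].
  by rewrite (last_nth set0); exact: (Kh (size h)).
split.
  move=> h _ posh; have [Kh inch] := posh; have Kl := Klast h posh.
  split=> i; rewrite size_rcons ltnS.
    rewrite leq_eqVlt => /predU1P[->|ih]; rewrite nth_rcons.
      by rewrite ltnn eqxx; exact: (EP _ _ Kl).1.
    by rewrite ih; exact: Kh.
  rewrite !nth_rcons => ih; rewrite ih.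
  case: ltnP => [|hi]; first exact: inch.
  have hE : size h = i.+1 by apply/eqP; rewrite eqn_leq hi.
  rewrite hE eqxx.
  have -> : nth set0 h i = last S0 h.
    by case: h hE {posh Kh inch Kl ih hi} => // x h [<-]; rewrite (last_nth set0).
  exact: (EP _ _ Kl).2.
move=> S posS Ssigma; apply: EX.
- apply: subset_trans (bigcup_sup (i := 0) _) => //.
  by have := Ssigma 0; rewrite /= => ->; exact: (EP _ _ KS0).2.
- move=> k; exists (last S0 (mkseq S k.*2)); first exact: Klast.
  apply: subset_trans (bigcup_sup (i := k.*2) _) => //.
  by rewrite Ssigma size_mkseq doubleK.
Qed.

(** * Blocking the maps of a position into [Phi] *)

Definition weakly_injective_at Phi S : Prop :=
  exists T, [/\ KG str G T, S `<=` T, T `<=` Phi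
    & forall U, KG str G U -> T `<=` U ->
        exists2 phi, embedding str G U Phi phi
                   & forall x, pdom S x -> phi (x, x)].

(* [a] is the value on [s] of the inverse [h] of a member of [G]. *)
Definition no_map_into Phi (s a : seq M) P : Prop :=
  forall g h, G g -> cancel g h -> cancel h g -> map h s = a ->
    ~ conj_map g P `<=` Phi.

Lemma no_map_intoS Phi s a P Q :
  P `<=` Q -> no_map_into Phi s a P -> no_map_into Phi s a Q.
Proof.
move=> PQ noP g h Gg gh hg ha QPhi; apply: (noP g h Gg gh hg ha).
by apply: subset_trans QPhi; exact: image_subset.
Qed.

(** Totality of [X] forces [phi] to be defined everywhere, hence to be the full graph of the [g]
    that extends it. *)
Lemma isomorphism_total X Phi phi : (forall x, pdom X x) ->
  isomorphism str G X Phi phi -> exists2 g, G g & conj_map g X `<=` Phi.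
Proof.
move=> Xtot [[[g Gg gphi] _ zd inc] _]; exists g => // _ [[x y] Xxy <-] /=.
have phig z : phi (z, g z).
  have [[z' w] pw /= ez] : pdom phi z by apply: zd; left.
  by rewrite ez in pw; rewrite -(gphi _ _ pw).
have [|w phixw Phiw] := inc (x, g y); first by exists y.
by rewrite -(gphi _ _ phixw).
Qed.

Lemma embedding_graph g X Phi : G g -> conj_map g X `<=` Phi ->
  embedding str G X Phi [set p | p.2 = g p.1].
Proof.
move=> Gg gX.
have domT z : pdom [set p | p.2 = g p.1] z by exists (z, g z).
split.
- by exists g.
- by move=> f t _; exact: domT.
- by move=> x _; exact: domT.
- move=> [x z] [y Xxy /= ->]; exists (g x) => //=.
  by apply: gX; exists (x, y).
Qed.

Lemma KG_extend_no_map_into Phi S s a P :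
  sigmaKG str G Phi -> KG str G S -> S `<=` Phi ->
  pdom S = smallest (substructure str) [set` s] ->
  ~ weakly_injective_at Phi S -> KG str G P ->
  exists Q, [/\ KG str G Q, P `<=` Q & no_map_into Phi s a Q].
Proof.
move=> [C [KC Cinc PhiE]] KS SPhi domS notS KP.
have [noP|] := pselect (no_map_into Phi s a P); first by exists P; split.
move=> /existsNP[g /existsNP[h]] /not_implyP[Gg] /not_implyP[gh].
move=> /not_implyP[hg] /not_implyP[ha] /contrapT gP.
have Gh : G h by case: Ggroup => _ _ _ inv; exact: inv gh hg.
have KgP := KG_conj_map Gg KP.
have [i SC] : exists i, S `<=` C i.
  by apply: KG_subset_bigcup => //; rewrite -PhiE.
have [j PC] : exists j, conj_map g P `<=` C j.
  by apply: KG_subset_bigcup => //; rewrite -PhiE.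
have Cmono := chain_subset Cinc.
(* A member of the chain with union [Phi] is both in [KG] and below [Phi], as the failure at [S]
   requires of [T]. *)
pose T := C (maxn i j).
have ST : S `<=` T := subset_trans SC (Cmono _ _ (leq_maxl i j)).
have PT : conj_map g P `<=` T := subset_trans PC (Cmono _ _ (leq_maxr i j)).
have TPhi : T `<=` Phi by rewrite PhiE; exact: bigcup_sup.
have [U [KU TU noU]] : exists U, [/\ KG str G U, T `<=` U
    & forall phi, embedding str G U Phi phi -> ~ forall x, pdom S x -> phi (x, x)].
  apply: contrapT => noU; apply: notS; exists T; split => //; first exact: KC.
  move=> U KU TU; apply: contrapT => nophi; apply: noU; exists U; split => //.
  by move=> phi ephi fixphi; apply: nophi; exists phi.
exists (conj_map h U); split; first exact: KG_conj_map.
  move=> [x y] Pxy; exists (g x, g y); last by rewrite /= !gh.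
  by apply: TU; apply: PT; exists (x, y).
move=> g1 h1 Gg1 gh1 hg1 ha1 UPhi.
have G1h : G (g1 \o h) by case: Ggroup => _ _ comp _; exact: comp.
(* If [g1] maps the pullback of [U] into [Phi], then [g1 \o h] maps [U] itself there. *)
apply: (noU [set p | p.2 = (g1 \o h) p.1]).
  apply: embedding_graph => //; apply: subset_trans UPhi.
  by move=> _ [p Up <-]; exists (h p.1, h p.2) => //; exists p.
(* The fixed points of [g1 \o h] form a substructure, so it suffices to treat the entries of [s].
   There [h] and [h1] agree, both having value [a], and [g1] inverts [h1]. *)
move=> x; rewrite domS => /(_ [set x | (g1 \o h) x = x]) fix_x.
apply: esym; apply: fix_x; split; first by apply: substructure_fixed; exact: Gaut.
move=> y /= ys.
have /eq_in_map/(_ y ys) -> : map h s = map h1 s by rewrite ha ha1.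
exact: hg1.
Qed.

End ExtendableMaps.

Theorem theorem3p4 (R : realType) (L : language) (M : countType)
    (str : structure L M) (G : set (M -> M)) (Phi : partial_map M)
    (Ggroup : permutation_group G)
    (Gaut : forall g : M -> M, G g -> automorphism str g)
    (Gpolish : polish_group R G)
    (Phi_sigma : sigmaKG str G Phi)
    (Phi_not_winj : ~ weakly_injective str G Phi) :
  exists sigma : seq (partial_map M) -> partial_map M,
    eve_winning_strategy str G Phi sigma.
Proof.
have [emb|] := pselect (forall S, KG str G S ->
    exists phi, embedding str G S Phi phi); last first.
  move=> /existsNP[S] /not_implyP[KS noS].
  (* After opening with [S] Eve merely repeats the last move; an isomorphism from the union onto
     [Phi] would also embed [S]. *)
  apply: (eve_wins_by_extending (E := fun _ P => P) KS).
    by move=> _ P KP; split.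
  move=> X SX _ [phi [ephi _]].
  by apply: noS; exists phi; exact: embeddingSl ephi.
have [S [KS SPhi notS]] : exists S,
    [/\ KG str G S, S `<=` Phi & ~ weakly_injective_at str G Phi S].
  apply: contrapT => noS; apply: Phi_not_winj; split => // S KS SPhi.
  by apply: contrapT => notS; apply: noS; exists S.
have [[F /finite_seqP[s Fs] domS] _ _] := KS; rewrite {}Fs in domS.
(* One index [k] serves two enumerations: it is decoded both as a point to put in the domain and as
   a tuple to rule out, and a failed decoding asks for nothing. Placing [KG] under the existential
   lets [choice] produce a total [E]. *)
have stage (kP : nat * partial_map M) : exists Q, KG str G kP.2 ->
    [/\ KG str G Q, kP.2 `<=` Q,
        forall x : M, unpickle kP.1 = Some x -> pdom Q x
      & forall a : seq M, unpickle kP.1 = Some a -> no_map_into G Phi s a Q].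
  case: kP => k P /=; have [KP|] := pselect (KG str G P); last by exists P.
  have [Q1 [KQ1 PQ1 domQ1]] : exists Q, [/\ KG str G Q, P `<=` Q
      & forall x : M, unpickle k = Some x -> pdom Q x].
    case: (@unpickle M k) => [x|]; last by exists P; split.
    have [Q [KQ PQ Qx]] := KG_extend_pdom Ggroup Gaut x KP.
    by exists Q; split => // _ [<-].
  case: (@unpickle (seq M) k) => [a|]; last by exists Q1 => _; split.
  have [Q [KQ Q1Q noQ]] :=
    KG_extend_no_map_into Ggroup Gaut a Phi_sigma KS SPhi domS notS KQ1.
  exists Q => _; split => //; first exact: subset_trans Q1Q.
    by move=> x /domQ1; exact: pdomS.
  by move=> _ [<-].
have [E Estage] := choice stage.
apply: (eve_wins_by_extending (E := fun k P => E (k, P)) KS) => [k P KP|X _ EX].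
  by have [] := Estage (k, P) KP.
move=> [phi isophi].
have Xtot x : pdom X x.
  have [P KP EPX] := EX (pickle x).
  have [_ _ domE _] := Estage (pickle x, P) KP.
  exact: pdomS EPX _ (domE x (pickleK x)).
have [g Gg gX] := isomorphism_total Xtot isophi.
have [h [_ gh hg]] := permutation_group_inv Ggroup Gg.
(* The task coded by the value of [h] on [s] has already excluded this very [g]. *)
have [P KP EPX] := EX (pickle (map h s)).
have [_ _ _ noE] := Estage (pickle (map h s), P) KP.
have noX := no_map_intoS EPX (noE (map h s) (pickleK (map h s))).
exact: noX g h Gg gh hg erefl gX.
Qed.
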